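(* Let $\mathfrak L$ be a generalized Laguerre space over a ruled quadric $Q$ of dimension $\nu\geq 3$, with point set $S$, set $\mathcal G$ of projective lines and set $\mathcal K$ of projective cones. Then the point-line structure $\langle S,\mathcal G\rangle$ (with incidence $\in$) is definable in the structure $\mathscr C=\langle\mathcal G,\mathcal K,\subset\rangle$ of conic pencils.
   Context: Setting. $\mathfrak P$ is a finite-dimensional Pappian non-Fanoian projective space (i.e. a projective space over a commutative field of characteristic $\neq 2$). $T,B$ are transversal (disjoint and together spanning $\mathfrak P$) nonempty subspaces of $\mathfrak P$, and $Q$ is a nondegenerate quadric in $B$ which is ruled (it contains a projective line). $\nu$ is the dimension of $Q$, i.e. $\nu=\dim(B)-1$, and it is assumed that $\nu\ge 3$ (so that every point of $S$ is the vertex of some projective cone). $S_0$ is the projective cone with vertex $T$ over $Q$, and $S=S_0\setminus T$ is the point set of $\mathfrak L$. $\mathcal G$ (projective lines) is the set of lines of $\mathfrak P$ contained in $S_0$ and disjoint from $T$. $\mathcal K$ (projective cones) is the set of all sets $S'=S_0\cap V$, where $V$ is a $3$-dimensional projective subspace of $\mathfrak P$ such that $V\cap S_0$ is a quadratic cone over a nondegenerate conic whose vertex is a point of $S$ (then $V\cap T=\emptyset$). $\mathscr C=\langle\mathcal G,\mathcal K,\subset\rangle$ is the two-sorted structure with inclusion between elements of $\mathcal G$ and elements of $\mathcal K$ as its only relation. Meaning of definability: each point $a\in S$ is identified with the set $\{L\in\mathcal G: a\in L\}$ of projective lines through it, so that $\langle S,\mathcal G,\in\rangle\cong\langle\{\{L\in\mathcal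 G:a\in L\}:a\in S\},\mathcal G,\ni\rangle$. The assertion is that the family $\{\{L\in\mathcal G:a\in L\}:a\in S\}$ is definable in $\mathscr C$, i.e. there is a parameter-free first-order formula $\varphi(L,S')$ in the language of $\mathscr C$, with $L$ of sort $\mathcal G$ and $S'$ of sort $\mathcal K$, such that $\{\{L\in\mathcal G:\mathscr C\models\varphi(L,S')\}:S'\in\mathcal K\}=\{\{L\in\mathcal G:a\in L\}:a\in S\}$. *)

(* Defs.v *)
From HB Require Import structures.
From mathcomp Require Import all_boot all_order all_algebra.
From mathcomp Require Import boolp classical_sets.

Set Implicit Arguments.
Unset Strict Implicit.
Unset Printing Implicit Defensive.

Import GRing.Theory.

Local Open Scope classical_set_scope.
Local Open Scope ring_scope.

(* The projective space P(V) of a finite-dimensional vector space V: its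
   subspaces are the {vspace V}, a projective dimension being one less than
   the vector dimension; point sets are of type [set (proj_point V)]. *)
Section ProjectiveSpace.
Context {F : fieldType} {V : vectType F}.

Definition proj_point : Type := {p : {vspace V} | \dim p == 1%N}.

Definition proj_dim (U : {vspace V}) : nat := (\dim U).-1.

Definition pts (U : {vspace V}) : set proj_point := [set p | (val p <= U)%VS].

(* In characteristic different from 2, a quadric of U is the set of
   self-conjugate points of a symmetric bilinear form on U. *)
Definition quadric_of (U : {vspace V}) (f : {symmetric (subvs_of U)}) :
    set proj_point :=
  [set p | pts U p /\ forall u : subvs_of U, vsval u \in val p -> f u u = 0].

Definition nondegenerate_quadric (U : {vspace V}) (Q : set proj_point) : Prop :=
  exists2 f : {symmetric (subvs_of U)}, nondegenerate f & Q = quadric_of f.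

Definition ruled (Q : set proj_point) : Prop :=
  exists2 L : {vspace V}, proj_dim L = 1%N & pts L `<=` Q.

(* The union of the joins of T with the points of Q. *)
Definition cone (T : {vspace V}) (Q : set proj_point) : set proj_point :=
  [set z | exists2 x, Q x & pts (T + val x)%VS z].

(* The empty zero set of an anisotropic form is not a conic. *)
Definition nondegenerate_conic (E : {vspace V}) (C : set proj_point) : Prop :=
  [/\ proj_dim E = 2%N, nondegenerate_quadric E C & C !=set0].

Definition quadratic_cone (a : proj_point) (X : set proj_point) : Prop :=
  exists E C, [/\ nondegenerate_conic E C, ~ pts E a & X = cone (val a) C].

End ProjectiveSpace.

Arguments proj_point {F} V.

Section LaguerreSpace.
Context {F : fieldType} {V : vectType F}.
Variables (T : {vspace V}) (Q : set (proj_point V)).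

Definition laguerre_points : set (proj_point V) := cone T Q `\` pts T.

Definition projective_line : Type :=
  {L : {vspace V} |
    [/\ proj_dim L = 1%N, pts L `<=` cone T Q & pts L `&` pts T = set0]}.

Definition projective_cone : Type :=
  {X : set (proj_point V) |
    exists2 W : {vspace V}, proj_dim W = 3%N &
      X = cone T Q `&` pts W /\
      exists2 a, laguerre_points a & quadratic_cone a X}.

Definition line_points (L : projective_line) : set (proj_point V) := pts (sval L).

Definition pencil (a : proj_point V) : set projective_line :=
  [set L | line_points L a].

End LaguerreSpace.

Arguments pencil {F V} T Q a _.

Record two_sorted := TwoSorted {
  sort1 : Type;
  sort2 : Type;
  rel12 : sort1 -> sort2 -> Prop
}.

(* First-order formulas with equality in the language of two-sorted structures
   with one relation symbol; [formula m n] has m free variables of the first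
   sort and n of the second. Variables are de Bruijn indices: a quantifier
   binds index 0 of its sort and shifts the others. *)
Inductive formula : nat -> nat -> Type :=
| Rel m n (i : 'I_m) (j : 'I_n) : formula m n
| Eq1 m n (i j : 'I_m) : formula m n
| Eq2 m n (i j : 'I_n) : formula m n
| Not m n (f : formula m n) : formula m n
| And m n (f g : formula m n) : formula m n
| Or m n (f g : formula m n) : formula m n
| Imp m n (f g : formula m n) : formula m n
| All1 m n (f : formula m.+1 n) : formula m n
| All2 m n (f : formula m n.+1) : formula m n
| Ex1 m n (f : formula m.+1 n) : formula m n
| Ex2 m n (f : formula m n.+1) : formula m n.

Fixpoint holds (M : two_sorted) (m n : nat) (f : formula m n) :
    m.-tuple (sort1 M) -> n.-tuple (sort2 M) -> Prop :=
  match f in formula m n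
    return m.-tuple (sort1 M) -> n.-tuple (sort2 M) -> Prop with
  | Rel _ _ i j => fun s t => rel12 (tnth s i) (tnth t j)
  | Eq1 _ _ i j => fun s t => tnth s i = tnth s j
  | Eq2 _ _ i j => fun s t => tnth t i = tnth t j
  | Not _ _ g => fun s t => ~ holds g s t
  | And _ _ g h => fun s t => holds g s t /\ holds h s t
  | Or _ _ g h => fun s t => holds g s t \/ holds h s t
  | Imp _ _ g h => fun s t => holds g s t -> holds h s t
  | All1 _ _ g => fun s t => forall x, holds g [tuple of x :: s] t
  | All2 _ _ g => fun s t => forall y, holds g s [tuple of y :: t]
  | Ex1 _ _ g => fun s t => exists x, holds g [tuple of x :: s] t
  | Ex2 _ _ g => fun s t => exists y, holds g s [tuple of y :: t]
  end.

(* A family of subsets of the first sort is definable when it consists of the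
   sets cut out by one parameter-free formula phi(x, y), y ranging over the
   whole second sort. *)
Definition definable_family (M : two_sorted) (A : set (set (sort1 M))) : Prop :=
  exists phi : formula 1 1,
    range (fun y => [set x | holds phi [tuple x] [tuple y]]) = A.

Definition conic_pencils (F : fieldType) (V : vectType F) (T : {vspace V})
    (Q : set (proj_point V)) : two_sorted :=
  @TwoSorted (projective_line T Q) (projective_cone T Q)
    (fun L X => line_points L `<=` sval X).

(* Main.v *)
(* The set Q is given by a form on B; pulled back along the projection onto B
   it becomes a symmetric form f on the whole space with radical T, whose
   isotropic points are those of the cone.  Every line contained in a projective
   cone passes through its vertex, and two distinct lines meet in at most one
   point, so two cones sharing two distinct lines have the same vertex.  Hence
   "X and X1 share two lines, X1 and X2 share two lines, and L lies in X2" forces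
   L to pass through the vertex a of X.  Conversely, if a lies on L = <a, l>,
   take two lines <a, p>, <a, q> of X with f(p, q) <> 0.  Whenever l is not
   orthogonal to p nor to q, the span of a, p, q, l cuts out a cone containing
   both lines and L.  In the other cases, since dim B >= 5, there is an
   anisotropic w orthogonal to a, p, q such that the cone X1 in <a, p, q, w> contains
   lines <a, x>, <a, x'> with f(x, x'), f(l, x), f(l, x') all nonzero. *)

From HB Require Import structures.
Require Import Defs.
From mathcomp Require Import all_boot all_order all_algebra.
From mathcomp Require Import boolp classical_sets.
From mathcomp Require Import ring.

Set Implicit Arguments.
Unset Strict Implicit.
Unset Printing Implicit Defensive.

Import GRing.Theory.

Local Open Scope classical_set_scope.
Local Open Scope ring_scope.

(** * Sums of lines and subspaces, and the points they contain *)

Section Subspaces.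
Context {F : fieldType} {V : vectType F}.
Implicit Types (a u v : V) (U W : {vspace V}) (p : proj_point V).

Lemma memv_line_addP a U v :
  reflect (exists k, v - k *: a \in U) (v \in <[a]> + U)%VS.
Proof.
apply: (iffP memv_addP) => [[_ /vlineP[k ->] [u uU ->]]|[k vU]].
  by exists k; rewrite addrC addKr.
by exists (k *: a); [exact: memvZ (memv_line a)|exists (v - k *: a); rewrite ?subrKC].
Qed.

Lemma dim_line_add a U : a \notin U -> \dim (<[a]> + U) = (\dim U).+1.
Proof.
move=> aU; rewrite dimv_disjoint_sum ?dim_vline.
  by case: eqP aU => // ->; rewrite mem0v.
apply/eqP; rewrite -subv0; apply/subvP => v; rewrite memv_cap => /andP[].
move=> /vlineP[k ->] kaU; rewrite memv0 scaler_eq0; case: eqP => //= /eqP k0.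
by case/negP: aU; rewrite -(scalerK k0 a) memvZ.
Qed.

Lemma mem_line_addl a U : a \in (<[a]> + U)%VS.
Proof. by apply: subvP (addvSl _ _) _ _; exact: memv_line. Qed.

Lemma mem_line_addr a u U : u \in U -> u \in (<[a]> + U)%VS.
Proof. by apply: subvP (addvSr _ _) _. Qed.

Lemma span3_coord (p q w u : V) : u \in (<[p]> + (<[q]> + <[w]>))%VS ->
  exists x y z, u = x *: p + y *: q + z *: w.
Proof.
move=> /memv_line_addP[x /memv_line_addP[y /vlineP[z /eqP]]].
rewrite !subr_eq => /eqP ->; exists x, y, z.
by rewrite [LHS]addrC [X in _ + X]addrC addrA.
Qed.

Lemma memv_span3 (p q w : V) x y z :
  x *: p + y *: q + z *: w \in (<[p]> + (<[q]> + <[w]>))%VS.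
Proof. by rewrite -addrA !memv_add // memvZ // memv_line. Qed.

Lemma vsvalZ U k (u : subvs_of U) : vsval (k *: u) = k *: vsval u.
Proof. exact: linearZ. Qed.

(** Kept transparent, so that its underlying subspace reduces to [<[u]>] by computation. *)
Definition span_point u (u0 : u != 0) : proj_point V.
Proof. by exists <[u]>%VS; rewrite dim_vline u0. Defined.

Lemma proj_pointP p : exists2 u, u != 0 & val p = <[u]>%VS.
Proof.
case: p => P /= /eqP P1; have P0 : P != 0%VS by rewrite -dimv_eq0 P1.
exists (vpick P); rewrite ?vpick0 //; apply/esym/eqP.
by rewrite eqEdim -memvE memv_pick P1 dim_vline vpick0 P0.
Qed.

Lemma subset_pts U W : pts U `<=` pts W -> (U <= W)%VS.
Proof.
move=> UW; apply/subvP => u uU; have [->|u0] := eqVneq u 0; first exact: mem0v.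
by rewrite memvE; apply: (UW (span_point u0)); rewrite /pts /= -memvE.
Qed.

End Subspaces.

(** * Symmetric bilinear forms, radicals and pullbacks *)

Section SymmetricForms.
Context {F : fieldType}.

Section Theory.
Context {V : vectType F} (f : {symmetric V}).
Implicit Types u v w : V.

Lemma symC u v : f u v = f v u.
Proof. by rewrite hermC /= expr0 mul1r. Qed.

Lemma symDr u v w : f u (v + w) = f u v + f u w.
Proof. exact: linearDr. Qed.

Lemma symZr k u v : f u (k *: v) = k * f u v.
Proof. exact: linearZr_LR. Qed.

Lemma symDl u v w : f (u + v) w = f u w + f v w.
Proof. exact: linearDl. Qed.

Lemma symZl k u v : f (k *: u) v = k * f u v.
Proof. exact: linearZl_LR. Qed.

Lemma symNr u v : f u (- v) = - f u v.
Proof. exact: linearNr. Qed.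

Lemma symNl u v : f (- u) v = - f u v.
Proof. exact: linearNl. Qed.

Lemma sym0r u : f u 0 = 0.
Proof. exact: linear0r. Qed.

Lemma sym0l u : f 0 u = 0.
Proof. exact: linear0l. Qed.

Definition symE := (symDl, symDr, symNl, symNr, symZl, symZr, sym0l, sym0r).

Lemma nondegenerateP :
  reflect (forall u, (forall v, f u v = 0) -> u = 0) (nondegenerate f).
Proof.
apply: (iffP eqP) => [rad0 u gu|rad0].
  by apply/eqP; rewrite -memv0 -rad0; apply/mem_orthovP => v _.
apply/eqP; rewrite -subv0; apply/subvP => u /mem_orthovP gu.
by rewrite memv0; apply/eqP/rad0 => v; apply: gu; rewrite memvf.
Qed.

(* A totally isotropic plane in dimension 3 meets the orthogonal of any vector
   outside of it, which puts a nonzero vector in the radical. *)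
Lemma ternary_anisotropic_plane (W : {vspace V}) :
  nondegenerate f -> \dim {:V} = 3%N -> (1 < \dim W)%N ->
  ~ (forall u v, u \in W -> v \in W -> f u v = 0).
Proof.
move=> /nondegenerateP ndg dimU dimW fW.
(* [W] has codimension at most 1, so one vector completes it; 0 serves when [W] is already
   everything. *)
have [w fullE] : exists w, (<[w]> + W)%VS = fullv.
  have [->|Wf] := eqVneq W fullv; first by exists 0; rewrite addvf.
  have [w wW] : exists w, w \notin W.
    apply: contrapT => /forallNP allW; case/negP: Wf; rewrite eqEsubv subvf.
    by apply/subvP => u _; apply/negPn/negP/allW.
  by exists w; apply/eqP; rewrite eqEdim subvf dimU dim_line_add.
have : (0 < \dim (W :&: orthov f <[w]>))%N.
  by apply: leq_trans (leq_dim_orthov1 f w W); case: (\dim W) dimW => [|[]].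
rewrite lt0n dimv_eq0 -vpick0 => /negP; apply; apply/eqP/ndg => v.
have := memv_pick (W :&: orthov f <[w]>)%VS; set z := vpick _.
rewrite memv_cap mem_orthov1 => /andP[zW /eqP zw].
have := memvf v; rewrite -fullE => /memv_line_addP[k vW].
by rewrite -(subrK (k *: w) v) symDr symZr zw mulr0 addr0 fW.
Qed.

End Theory.

Section Pullback.
Context {U V : vectType F} (g : {symmetric U}) (h : {linear V -> U}).

(** Serves twice: along the projection onto [B] it extends the form of [Q] to the whole space, and
    along an inclusion it restricts a form to a subspace. *)
Definition pullback u v := g (h u) (h v).

Let pullback_bilinear :
  bilinear_for *%R (idfun \; *%R) (pullback : V -> V -> F).
Proof.
by split=> [v k u w|u k v w]; rewrite /pullback linearP !symE.
Qed.

Let pullback_sym u v : pullback u v = (-1) ^+ false * idfun (pullback v u).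
Proof. by rewrite /pullback symC expr0 mul1r. Qed.

HB.instance Definition _ :=
  bilinear_isBilinear.Build F V V F *%R (idfun \; *%R) pullback pullback_bilinear.
HB.instance Definition _ :=
  isHermitianSesquilinear.Build F V false idfun pullback pullback_sym.

Definition pullback_form : {symmetric V} := pullback.

End Pullback.
End SymmetricForms.

(** * Isotropic points, lines on quadratic cones, and cones as isotropic sets *)

Section Isotropy.
Context {F : fieldType} {V : vectType F}.
Hypothesis two_neq0 : (2 : F) != 0.
Implicit Types (f : {symmetric V}) (U W : {vspace V}) (u v a : V).

Definition isotropic f : set (proj_point V) :=
  [set p : proj_point V | forall u, u \in val p -> f u u = 0].

(** Polarization: once [u], [v] and [u + v] are isotropic, [2 * f u v] vanishes. *)
Lemma pts_isotropicP f U :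
  pts U `<=` isotropic f <-> forall u v, u \in U -> v \in U -> f u v = 0.
Proof.
split=> [UI u v uU vU|Uf p pU u /(subvP pU) uU]; last exact: Uf.
have sq w : w \in U -> f w w = 0.
  have [->|w0] := eqVneq w 0; first by rewrite sym0l.
  by rewrite memvE => wU; apply: (UI (span_point w0) wU); rewrite memv_line.
have := sq _ (memvD uU vU); rewrite !symE (sq _ uU) (sq _ vU) add0r addr0.
by rewrite (symC f v u) -mulr2n -mulr_natl => /eqP; rewrite mulf_eq0 (negPf two_neq0) => /eqP.
Qed.

(** As [u] is isotropic, the condition on [k] has no quadratic term: it reads
    [f v v + 2 * k * f u v = 0]. *)
Lemma isotropize f u v : f u u = 0 -> f u v != 0 ->
  exists k, f (v + k *: u) (v + k *: u) = 0.
Proof.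
move=> u0 uv; exists (- (f v v) / (2 * f u v)).
by rewrite !symE u0 (symC f v u); field; apply/andP.
Qed.

(* Projecting a line of the cone from the vertex onto the base plane would
   otherwise yield a totally isotropic plane of a nondegenerate ternary form. *)
Lemma quadratic_cone_line (a : proj_point V) (X : set (proj_point V)) U :
  quadratic_cone a X -> \dim U = 2%N -> pts U `<=` X -> (val a <= U)%VS.
Proof.
move=> [E [C [[dimE [g ndg ->] _] aE ->]]] dimU UX.
have {}dimE : \dim E = 3%N.
  by move: dimE; rewrite /proj_dim; case: (\dim E) => //= n ->.
have [a0 a0n0 aE0] := proj_pointP a.
have aEn : a0 \notin E.
  by apply/negP => aEi; apply: aE; rewrite /pts /= aE0 -memvE.
have noE k : k *: a0 \in E -> k = 0.
  by rewrite rpredZeq (negPf aEn) orbF => /eqP.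
rewrite aE0 -memvE; apply/negPn/negP => aU.
have UE : (U <= <[a0]> + E)%VS.
  apply: subset_pts => x /UX [y [yE _]]; rewrite /pts /= aE0 => xy.
  by apply: subv_trans xy _; rewrite addvS.
(* The image of [U] under projection from the vertex into the base plane [E]. *)
pose U' := (E :&: (<[a0]> + U))%VS.
have iso_U' e : e \in U' -> g (vsproj E e) (vsproj E e) = 0.
  rewrite memv_cap => /andP[eE /memv_line_addP[k]]; set u := e - _ => uU.
  have [u0|u0] := eqVneq u 0.
    have ea : e = k *: a0 by apply/eqP; rewrite -subr_eq0 -/u u0.
    by move: eE; rewrite ea => /noE ->; rewrite scale0r linear0 sym0l.
  have [x [xE xg]] := UX (span_point u0) (uU : (_ <= _)%VS).
  rewrite /pts /= -memvE aE0 => /memv_line_addP[k' kx].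
  (* The point [x] of the conic is the one whose join with the vertex contains [u]. Both [e] and
     [u - k' *: a0] lie in [E] and differ by a multiple of [a0], so they coincide. *)
  suff ex : e \in val x by apply: xg; rewrite vsprojK.
  suff <- : u - k' *: a0 = e by [].
  have : (k + k') *: a0 \in E.
    have -> : (k + k') *: a0 = e - (u - k' *: a0).
      by rewrite scalerDl /u !opprD !opprK addrA addrA subrr add0r.
    exact: memvB eE (subvP xE _ kx).
  by move=> /noE kk; rewrite /u -addrA -opprD -scalerDl kk scale0r subr0.
(* Inside [<[a0]> + E], of dimension 4, two subspaces of dimension 3 meet in dimension at least
   2. *)
have dimU' : (1 < \dim U')%N.
  rewrite -(leq_add2l (\dim (E + (<[a0]> + U)))) dimv_sum_cap dimE dim_line_add // dimU.
  rewrite -[leqRHS]/(4 + 2)%N leq_add2r.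
  apply: (@leq_trans (\dim (<[a0]> + E))%N); last by rewrite dim_line_add ?dimE.
  by apply: dimvS; rewrite subv_add addvSr subv_add addvSl.
pose h : 'Hom(V, subvs_of E) := linfun (vsproj E).
apply: (@ternary_anisotropic_plane _ _ g (h @: U')%VS) => //.
- by rewrite dimvf.
- rewrite limg_dim_eq //; apply/eqP; rewrite -subv0; apply/subvP => e.
  rewrite !memv_cap memv_ker lfunE /= => /andP[/andP[eE _] /eqP e0].
  by rewrite memv0 -(vsprojK eE) e0 linear0.
- have sq e : e \in (h @: U')%VS -> g e e = 0.
    by move=> /memv_imgP[e' e'U ->]; rewrite lfunE; exact: iso_U'.
  move=> u v uU vU; have := sq _ (memvD uU vU).
  rewrite !symE (sq _ uU) (sq _ vU) add0r addr0 (symC g v u) -mulr2n -mulr_natl.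
  by move/eqP; rewrite mulf_eq0 (negPf two_neq0) => /eqP.
Qed.

(** As [R] is orthogonal to [R + U], isotropy of [r + v] depends on [v] alone. The quadric must be
    nonempty for the points of [R] itself to lie on some join. *)
Lemma cone_isotropic f (R U : {vspace V}) (g : {symmetric (subvs_of U)}) :
    (forall r u, r \in R -> u \in (R + U)%VS -> f r u = 0) ->
    (forall u v : subvs_of U, g u v = f (vsval u) (vsval v)) ->
    quadric_of g !=set0 ->
  cone R (quadric_of g) = isotropic f `&` pts (R + U)%VS.
Proof.
move=> fR gf [x0 [x0U gx0]]; apply/seteqP; split=> z.
  move=> [x [xU gx] zRx]; have zRU : (val z <= R + U)%VS.
    by apply: subv_trans zRx _; rewrite addvS.
  split=> // u /(subvP zRx) /memv_addP[r rR [v vx ->]].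
  have vU := subvP xU _ vx.
  have frv : f r v = 0 by rewrite fR // (subvP (addvSr R U)).
  rewrite !symE fR // ?(subvP (addvSl R U)) // (symC f v r) frv !add0r.
  by have := gx (vsproj U v); rewrite gf vsprojK //; apply.
have [w w0 zE] := proj_pointP z.
move=> [fz]; rewrite /pts /= zE -memvE => /memv_addP[r rR [v vU wE]].
have [v0|v0] := eqVneq v 0.
  exists x0 => //; rewrite /pts /= zE -memvE wE v0 addr0.
  exact: (subvP (addvSl _ _)).
exists (span_point v0); last first.
  by rewrite /pts /= zE -memvE wE memv_add ?memv_line.
split; first by rewrite /pts /= -memvE.
move=> u /vlineP[k ukv]; rewrite gf ukv !symE.
suff -> : f v v = 0 by rewrite !mulr0.
have frv : f r v = 0 by rewrite fR // (subvP (addvSr R U)).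
have := fz w; rewrite zE memv_line wE !symE => /(_ isT).
by rewrite fR // ?(subvP (addvSl R U)) // (symC f v r) frv !add0r.
Qed.

End Isotropy.

(** * Projective lines, and the vertex shared by cones with two common lines *)

Section Laguerre.
Context {F : fieldType} {V : vectType F} (f : {symmetric V}) (T : {vspace V})
  (Q : set (proj_point V)).
Hypothesis two_neq0 : (2 : F) != 0.
Hypothesis coneE : cone T Q = isotropic f.
Hypothesis radP : forall u, (forall v, f u v = 0) <-> u \in T.

Implicit Types (X Y : projective_cone T Q) (K L : projective_line T Q).

Lemma rad_sym t v : t \in T -> f t v = 0.
Proof. by move=> /radP. Qed.

(** If the second generator [l] were in [<[a]> + T], some [l - k *: a] would be a point of [L] in
    [T]. *)
Lemma line_through a (b : proj_point V) L : val b = <[a]>%VS -> (val b <= sval L)%VS ->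
  exists l, [/\ sval L = (<[l]> + <[a]>)%VS, f a a = 0, f a l = 0, f l l = 0
    & l \notin (<[a]> + T)%VS].
Proof.
move=> bE; rewrite bE => aL; case: L aL => L [+ LI LT] /= aL.
rewrite coneE in LI; move/(pts_isotropicP two_neq0): LI => LI.
rewrite /proj_dim => dimL; have {}dimL : \dim L = 2%N.
  by case: (\dim L) dimL => //= n ->.
have a0 : a != 0.
  by have := valP b; rewrite bE dim_vline; case: (a != 0).
have [l lL la] : exists2 l, l \in L & l \notin <[a]>%VS.
  apply: contrapT => /forall2NP allL.
  have : (L <= <[a]>)%VS.
    by apply/subvP => l lL; case: (allL l) => // /negP /negPn.
  by move=> /dimvS; rewrite dimL dim_vline a0.
have LE : L = (<[l]> + <[a]>)%VS.
  apply/esym/eqP; rewrite eqEdim subv_add -memvE lL aL dimL.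
  by rewrite dim_line_add // dim_vline a0.
exists l; split; rewrite ?LI //.
apply/negP => /memv_line_addP[k lT].
have lk0 : l - k *: a != 0.
  by apply: contraNneq la => /eqP; rewrite subr_eq0 => /eqP ->; rewrite memvZ ?memv_line.
suff : (pts L `&` pts T) (span_point lk0) by rewrite LT.
by split; rewrite /pts /= -memvE // memvB // memvZ // memvE.
Qed.

(** The vector [q] certifies that the line misses [T]: a vector of [T] is orthogonal to [q], which
    kills its coefficient on [p], and [a] is outside [T]. *)
Lemma ex_line a p q : a \notin T -> f a a = 0 -> f a p = 0 -> f p p = 0 ->
    f a q = 0 -> f p q != 0 ->
  exists K : projective_line T Q, sval K = (<[p]> + <[a]>)%VS.
Proof.
move=> aT aa ap pp aq pq.
have pa : p \notin <[a]>%VS.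
  by apply: contraNN pq => /vlineP[k ->]; rewrite symE aq mulr0.
have a0 : a != 0 by apply: contraNneq aT => ->; rewrite mem0v.
have PK : [/\ proj_dim (<[p]> + <[a]>)%VS = 1%N,
    pts (<[p]> + <[a]>)%VS `<=` cone T Q & pts (<[p]> + <[a]>)%VS `&` pts T = set0].
  split.
  - by rewrite /proj_dim dim_line_add // dim_vline a0.
  - rewrite coneE; apply/(pts_isotropicP two_neq0).
    move=> u v /memv_line_addP[k /vlineP[k' /eqP]]; rewrite subr_eq => /eqP ->.
    move=> /memv_line_addP[m /vlineP[m' /eqP]]; rewrite subr_eq => /eqP ->.
    by rewrite !symE (symC f p a) aa ap pp !(mulr0, addr0).
  apply/seteqP; split=> // z [].
  have [u u0 zE] := proj_pointP z; rewrite /pts /= zE -!memvE.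
  move=> /memv_line_addP[k /vlineP[k' /eqP]]; rewrite subr_eq => /eqP uE uT.
  have := rad_sym q uT; rewrite uE !symE aq mulr0 add0r => /eqP.
  rewrite mulf_eq0 (negPf pq) orbF => /eqP k0.
  move: uT u0; rewrite uE k0 scale0r addr0 rpredZeq (negPf aT) orbF => /eqP ->.
  by rewrite scale0r eqxx.
by exists (exist (fun L : {vspace V} => [/\ proj_dim L = 1%N, pts L `<=` cone T Q
  & pts L `&` pts T = set0]) _ PK).
Qed.

Lemma line_inj K K' : sval K = sval K' -> K = K'.
Proof.
case: K K' => [L LP] [L' L'P] /= LL'; case: _ / LL' in L'P *.
by rewrite (Prop_irrelevance LP L'P).
Qed.

Definition vertex X (a : proj_point V) :=
  laguerre_points T Q a /\ quadratic_cone a (sval X).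

Lemma ex_vertex X : exists a, vertex X a.
Proof. by case: X => X [W dW [XE [a Sa qa]]]; exists a. Qed.

Lemma vertex_line X a L : vertex X a -> line_points L `<=` sval X -> (val a <= sval L)%VS.
Proof.
move=> [_ qX]; apply: (quadratic_cone_line two_neq0 qX).
by case: L => L [+ _ _] /=; rewrite /proj_dim; case: (\dim L) => //= n ->.
Qed.

(** The conjunctions are nested exactly as in [share_formula], so that [holds_pencil_formula] holds
    by computation. *)
Definition share_lines X Y := exists K K', K <> K' /\
  (line_points K `<=` sval X /\ line_points K' `<=` sval X) /\
  (line_points K `<=` sval Y /\ line_points K' `<=` sval Y).

(** Were the vertices distinct, each of the two shared lines would be their join. *)
Lemma share_vertex X Y a b : share_lines X Y -> vertex X a -> vertex Y b -> a = b.
Proof.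
move=> [K [K' [KK' [[KX K'X] [KY K'Y]]]]] vX vY.
have [aK aK'] := (vertex_line vX KX, vertex_line vX K'X).
have [bK bK'] := (vertex_line vY KY, vertex_line vY K'Y).
apply: contrapT => ab; apply: KK'.
have [a0 a0n aE] := proj_pointP a; have [b0 b0n bE] := proj_pointP b.
have ab0 : a0 \notin <[b0]>%VS.
  apply/negP => ab'; case: ab; apply: val_inj; apply/eqP.
  by rewrite aE bE eqEdim -memvE ab' !dim_vline a0n b0n.
have dimab : \dim (val a + val b) = 2%N by rewrite aE bE dim_line_add // dim_vline b0n.
have spanE (M : projective_line T Q) :
    (val a <= sval M)%VS -> (val b <= sval M)%VS ->
    sval M = (val a + val b)%VS.
  case: M => M [dM ? ?] /= aM bM; apply/esym/eqP; rewrite eqEdim subv_add aM bM dimab.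
  by move: dM; rewrite /proj_dim; case: (\dim M) => //= n ->.
by apply: line_inj; rewrite (spanE K) // (spanE K').
Qed.

(** * Construction of cones with a prescribed vertex *)

Section AtPoint.
Variables (a : proj_point V) (a0 : V).
Hypotheses (aE : val a = <[a0]>%VS) (Sa : laguerre_points T Q a).

Lemma point_notin_rad : a0 \notin T.
Proof. by apply/negP => aT; case: Sa => _; apply; rewrite /pts /= aE -memvE. Qed.

Lemma point_isotropic : f a0 a0 = 0.
Proof. by case: Sa; rewrite coneE => fa _; apply: fa; rewrite aE memv_line. Qed.

Lemma point_neq0 : a0 != 0.
Proof. by apply: contraNneq point_notin_rad => ->; rewrite mem0v. Qed.

(** Up to scaling, [p] and [q] are a hyperbolic pair in the orthogonal of [a0]: they span with [a0]
    two lines of the Laguerre space whose plane is not totally isotropic. *)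
Definition hyperbolic p q :=
  [/\ f a0 p = 0, f a0 q = 0, f p p = 0, f q q = 0 & f p q != 0].

(** The span of [p], [q], [w] is the orthogonal sum of a hyperbolic plane and an anisotropic line,
    so [f] cuts out there a nondegenerate conic containing [p]. It is orthogonal to [a0], whence the
    isotropic points of its join with [a0] form a cone over that conic. *)
Lemma ex_cone_anisotropic p q w : hyperbolic p q -> f a0 w = 0 -> f w p = 0 -> f w q = 0 ->
    f w w != 0 ->
  exists X, vertex X a /\
    sval X = isotropic f `&` pts (<[a0]> + (<[p]> + (<[q]> + <[w]>)))%VS.
Proof.
move=> [ap aq pp qq pq] aw wp wq ww.
have qp : f q p != 0 by rewrite symC.
pose E := (<[p]> + (<[q]> + <[w]>))%VS.
have pE : p \in E by rewrite mem_line_addl.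
have qE : q \in E by rewrite mem_line_addr // mem_line_addl.
have wE : w \in E by rewrite mem_line_addr // mem_line_addr // memv_line.
have aE0 u : u \in E -> f a0 u = 0.
  by move=> /span3_coord[x [y [z ->]]]; rewrite !symE ap aq aw !mulr0 !addr0.
have ndE u : u \in E -> (forall v, v \in E -> f u v = 0) -> u = 0.
  move=> /span3_coord[x [y [z ->]]] uE.
  move: (uE _ pE) (uE _ qE) (uE _ wE); rewrite !symE pp qq wp wq.
  rewrite (symC f p w) (symC f q w) wp wq !(mulr0, add0r, addr0).
  move=> /eqP; rewrite mulf_eq0 (negPf qp) orbF => /eqP ->.
  move=> /eqP; rewrite mulf_eq0 (negPf pq) orbF => /eqP ->.
  move=> /eqP; rewrite mulf_eq0 (negPf ww) orbF => /eqP ->.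
  by rewrite !scale0r !addr0.
have aNE : a0 \notin E.
  by apply/negP => /ndE a00; case/eqP: point_neq0; apply: a00 => v /aE0.
have dimE : \dim E = 3%N.
  have w0 : w != 0 by apply: contraNneq ww => ->; rewrite sym0l.
  have qw : q \notin <[w]>%VS.
    apply: contraNN qp => /vlineP[k ->]; by rewrite symZl wp mulr0.
  have pqw : p \notin (<[q]> + <[w]>)%VS.
    apply: contraNN pq => /memv_line_addP[k /vlineP[m /eqP]].
    by rewrite subr_eq => /eqP ->; rewrite !symE wq qq !mulr0 addr0.
  by rewrite !dim_line_add // dim_vline w0.
pose vs : {linear subvs_of E -> V} := vsval.
pose g : {symmetric (subvs_of E)} := pullback_form f vs.
have ndg : nondegenerate g.
  apply/nondegenerateP => u gu; apply/val_inj/ndE; first exact: subvsP.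
  by move=> v vE; have := gu (vsproj E v); rewrite /g /= /pullback /vs /= vsprojK.
have p0 : p != 0 by apply: contraNneq pq => ->; rewrite sym0l.
have gx : quadric_of g !=set0.
  exists (span_point p0); split; first by rewrite /pts /= -memvE.
  by move=> u /vlineP[k uk]; rewrite /g /= /pullback /vs /= uk !symE pp !mulr0.
have coneaE : cone (val a) (quadric_of g) = isotropic f `&` pts (<[a0]> + E)%VS.
  rewrite aE; apply: cone_isotropic => // r u /vlineP[k ->].
  move=> /memv_line_addP[m /aE0]; rewrite !symE point_isotropic mulr0 oppr0 addr0 => ->.
  by rewrite mulr0.
have qa : quadratic_cone a (isotropic f `&` pts (<[a0]> + E)%VS).
  exists E, (quadric_of g); split => //.
  - by split=> //; [rewrite /proj_dim dimE | exists g].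
  - by rewrite /pts /= aE -memvE; apply/negP.
have PX : exists2 W : {vspace V}, proj_dim W = 3%N &
      isotropic f `&` pts (<[a0]> + E)%VS = cone T Q `&` pts W /\
      exists2 b, laguerre_points T Q b &
        quadratic_cone b (isotropic f `&` pts (<[a0]> + E)%VS).
  exists (<[a0]> + E)%VS; first by rewrite /proj_dim dim_line_add // dimE.
  by rewrite coneE; split=> //; exists a.
by exists (exist (fun Z => exists2 W : {vspace V}, proj_dim W = 3%N &
      Z = cone T Q `&` pts W /\
      exists2 b, laguerre_points T Q b & quadratic_cone b Z) _ PX).
Qed.

(** Removing from [l] its component in the plane of [p] and [q] leaves [w] orthogonal to both, and
    isotropy of [l] gives [f w w = - 2 * f l p * f l q / f p q], which is nonzero. *)
Lemma ex_cone_isotropic p q l : hyperbolic p q -> f a0 l = 0 -> f l l = 0 -> f l p != 0 ->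
    f l q != 0 ->
  exists X, vertex X a /\
    exists W : {vspace V}, sval X = isotropic f `&` pts W /\
      [/\ a0 \in W, p \in W, q \in W & l \in W].
Proof.
move=> pq al ll lp lq; have [ap aq pp qq pqn] := pq.
pose w := l - (f l q / f p q) *: p - (f l p / f p q) *: q.
have wp : f w p = 0.
  by rewrite /w !symE pp (symC f q p); field.
have wq : f w q = 0.
  by rewrite /w !symE qq; field.
have aw : f a0 w = 0.
  by rewrite /w !symE ap aq al; ring.
have ww : f w w = - 2 * f l p * f l q / f p q.
  rewrite {2}/w symDr symNr symZr symDr symNr symZr wp wq.
  by rewrite /w !symE (symC f p l) (symC f q l) ll; field.
have [|X [vX XE]] := ex_cone_anisotropic pq aw wp wq.
  by rewrite ww !mulf_neq0 ?invr_eq0 // oppr_eq0.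
exists X; split=> //; exists (<[a0]> + (<[p]> + (<[q]> + <[w]>)))%VS; split=> //; split.
- exact: mem_line_addl.
- by rewrite mem_line_addr // mem_line_addl.
- by rewrite mem_line_addr // mem_line_addr // mem_line_addl.
- apply: mem_line_addr.
  have -> : l = (f l q / f p q) *: p + (f l p / f p q) *: q + 1 *: w.
    by rewrite scale1r /w -(addrA l) -opprD subrKC.
  exact: memv_span3.
Qed.

Lemma line_sub_cone X (W : {vspace V}) K : sval X = isotropic f `&` pts W ->
  (sval K <= W)%VS -> line_points K `<=` sval X.
Proof.
move=> XE KW z Kz; rewrite XE; split; last exact: subv_trans Kz KW.
by rewrite -coneE; have [_ KI _] := svalP K; exact: KI.
Qed.

Lemma ex_line_hyperbolic p q : hyperbolic p q ->
  exists K : projective_line T Q, sval K = (<[p]> + <[a0]>)%VS.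
Proof.
move=> [ap aq pp qq pq].
exact: (ex_line point_notin_rad point_isotropic ap pp aq pq).
Qed.

Lemma hyperbolicC p q : hyperbolic p q -> hyperbolic q p.
Proof. by move=> [? ? ? ? ?]; split=> //; rewrite symC. Qed.

Lemma lines_neq p q K K' : hyperbolic p q ->
  sval K = (<[p]> + <[a0]>)%VS -> sval K' = (<[q]> + <[a0]>)%VS -> K <> K'.
Proof.
move=> [ap aq pp qq pq] KE K'E KK'; case/negP: pq.
have : p \in (<[q]> + <[a0]>)%VS by rewrite -K'E -KK' KE mem_line_addl.
move=> /memv_line_addP[k /vlineP[m /eqP]]; rewrite subr_eq => /eqP ->.
by rewrite !symE qq aq !mulr0 addr0.
Qed.

Lemma share_of X Y (W W' : {vspace V}) p q : hyperbolic p q ->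
    sval X = isotropic f `&` pts W -> sval Y = isotropic f `&` pts W' ->
    a0 \in W -> p \in W -> q \in W -> a0 \in W' -> p \in W' -> q \in W' ->
  share_lines X Y.
Proof.
move=> pq XE YE aW pW qW aW' pW' qW'.
have [K KE] := ex_line_hyperbolic pq.
have [K' K'E] := ex_line_hyperbolic (hyperbolicC pq).
exists K, K'; split; first exact: lines_neq KE K'E.
by split; split; apply: line_sub_cone; rewrite ?XE ?YE // ?KE ?K'E subv_add -!memvE;
  apply/andP.
Qed.

End AtPoint.

(** * Reaching every line through the vertex by a chain of cones *)

Section Completeness.
Variables (a : proj_point V) (a0 : V).
Hypotheses (aE : val a = <[a0]>%VS) (Sa : laguerre_points T Q a).
Hypothesis dimV : (\dim T + 5 <= \dim {:V})%N.
Let aT := point_notin_rad aE Sa.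
Let aa := point_isotropic aE Sa.

Lemma ex_dual : exists b, f a0 b = 1.
Proof.
have [b ab] : exists b, f a0 b != 0.
  apply: contrapT => /forallNP ab; case/negP: aT; apply/radP => b.
  by apply/eqP/negPn/negP/ab.
by exists ((f a0 b)^-1 *: b); rewrite symZr mulVf.
Qed.

(** Pairing [l] with [y - f a0 y *: b] is the same as pairing [l - f l b *: a0] with [y], and the
    former vector is orthogonal to [a0]. *)
Lemma ex_perp_dual l : f a0 l = 0 -> l \notin (<[a0]> + T)%VS ->
  exists y, f a0 y = 0 /\ f l y != 0.
Proof.
move=> al lT; have [b ab] := ex_dual.
have [y ly] : exists y, f (l - f l b *: a0) y != 0.
  apply: contrapT => /forallNP ly; case/negP: lT; apply/memv_line_addP.
  by exists (f l b); apply/radP => y; apply/eqP/negPn/negP/ly.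
exists (y - f a0 y *: b); split; first by rewrite !symE ab mulr1 subrr.
by move: ly; rewrite !symE => /eqP ly; apply/eqP; contradict ly; rewrite -[RHS]ly; ring.
Qed.

(* A vector [b] with [f a0 b = 1] makes the span of [a0, b, p, q] nondegenerate;
   as [dim V - dim T >= 5], some vector projects outside of [T] onto its
   orthogonal complement, where [f] is therefore not identically zero. *)
Lemma ex_anisotropic p q : hyperbolic a0 p q ->
  exists w, [/\ f a0 w = 0, f w p = 0, f w q = 0 & f w w != 0].
Proof.
move=> [ap aq pp qq pq]; have [b ab] := ex_dual.
(* Multiples of [a0] make [p] and [q] orthogonal to [b]; all other products are preserved, since
   [a0] is orthogonal to itself, [p] and [q]. *)
pose p' := p - f b p *: a0; pose q' := q - f b q *: a0.
have bp' : f b p' = 0 by rewrite /p' !symE (symC f b a0) ab; ring.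
have bq' : f b q' = 0 by rewrite /q' !symE (symC f b a0) ab; ring.
have ap' : f a0 p' = 0 by rewrite /p' !symE aa ap; ring.
have aq' : f a0 q' = 0 by rewrite /q' !symE aa aq; ring.
have pp' : f p' p' = 0 by rewrite /p' !symE (symC f p a0) aa ap pp; ring.
have qq' : f q' q' = 0 by rewrite /q' !symE (symC f q a0) aa aq qq; ring.
have pq' : f p' q' = f p q by rewrite /p' /q' !symE (symC f p a0) aa ap aq; ring.
have pE : p = p' + f b p *: a0 by rewrite subrK.
have qE : q = q' + f b q *: a0 by rewrite subrK.
clearbody p' q'.
(* The orthogonal projection along the span of [a0], [b], [p'], [q']. The coefficient of [a0]
   contains [f b b] because [b] may fail to be isotropic. *)
pose pr v := v - f a0 v *: b - (f b v - f b b * f a0 v) *: a0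
  - (f q' v / f p q) *: p' - (f p' v / f p q) *: q'.
have pra v : f a0 (pr v) = 0 by rewrite /pr !symE ab aa ap' aq'; ring.
have prb v : f b (pr v) = 0 by rewrite /pr !symE (symC f b a0) ab bp' bq'; ring.
have prp' v : f p' (pr v) = 0.
  by rewrite /pr !symE (symC f p' b) bp' (symC f p' a0) ap' pp' pq'; field.
have prq' v : f q' (pr v) = 0.
  by rewrite /pr !symE (symC f q' b) bq' (symC f q' a0) aq' qq' (symC f q' p') pq'; field.
have prE u v : f u a0 = 0 -> f u b = 0 -> f u p' = 0 -> f u q' = 0 -> f u (pr v) = f u v.
  by move=> ua ub up uq; rewrite /pr !symE ua ub up uq; ring.
have prpr u v : f (pr u) (pr v) = f (pr u) v.
  by apply: prE; rewrite symC.
have prT u : pr u \in T -> u \in (<[b]> + (<[a0]> + (<[p']> + (<[q']> + T))))%VS.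
  move=> prT; apply/memv_line_addP; exists (f a0 u).
  apply/memv_line_addP; exists (f b u - f b b * f a0 u).
  apply/memv_line_addP; exists (f q' u / f p q).
  by apply/memv_line_addP; exists (f p' u / f p q).
clearbody pr.
pose perp z := [/\ f z a0 = 0, f z b = 0, f z p' = 0 & f z q' = 0].
have prP v : perp (pr v) by split; rewrite symC.
(* Otherwise polarization makes [f] vanish on the image of [pr], every [pr u] is in the radical [T],
   and four vectors together with [T] span the whole space. *)
have [z [za zb zp zq] zz] : exists2 z, perp z & f z z != 0.
  apply: contrapT => /forall2NP perp0.
  have {}perp0 z : perp z -> f z z = 0.
    by move=> zP; apply/eqP/negPn/negP; case: (perp0 z).
  have {}prT u : u \in (<[b]> + (<[a0]> + (<[p']> + (<[q']> + T))))%VS.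
    apply/prT/radP => v; rewrite -prpr.
    have [[ua ub up uq] [va vb vp vq]] := (prP u, prP v).
    have : perp (pr u + pr v).
      by split; rewrite symDl ?(ua, ub, up, uq) ?(va, vb, vp, vq) addr0.
    move=> /perp0; rewrite !symE !perp0 // add0r addr0 (symC f (pr v)).
    by rewrite -mulr2n -mulr_natl => /eqP; rewrite mulf_eq0 (negPf two_neq0) => /eqP.
  have : (fullv <= <[b]> + (<[a0]> + (<[p']> + (<[q']> + T))))%VS.
    by apply/subvP => u _; exact: prT.
  move=> /dimvS; apply/negP; rewrite -ltnNge; apply: leq_trans dimV.
  have dim1 (v : V) W : (\dim (<[v]> + W) <= (\dim W).+1)%N.
    apply: leq_trans (dimv_add_leqif _ _) _.
    by rewrite dim_vline; case: (v != 0); rewrite // ltnW.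
  rewrite !addnS addn0 ltnS; do 4 (apply: leq_trans (dim1 _ _) _; rewrite ltnS).
  exact: leqnn.
exists z; split=> //; first by rewrite symC.
- by rewrite pE !symE zp za mulr0 addr0.
- by rewrite qE !symE zq za mulr0 addr0.
Qed.

(** The form [g] defining the base conic is not given as a restriction of [f], so a pair with
    [g e d] nonzero is compared with [f] geometrically. If [f] vanished on the pair, their join
    would lie in [X], hence pass through the vertex, yet it lies in the base plane [E]. *)
Lemma cone_hyperbolic X : vertex X a -> exists p q, hyperbolic a0 p q /\
  exists W : {vspace V}, sval X = isotropic f `&` pts W /\
    [/\ a0 \in W, p \in W & q \in W].
Proof.
move=> [_ qX]; have [W dimW [XE _]] := svalP X.
have vX (U : {vspace V}) : \dim U = 2%N -> pts U `<=` sval X -> a0 \in U.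
  by move=> dimU; rewrite memvE -aE; exact: quadratic_cone_line.
have [E [C [[dimE [g ndg CE] [x Cx]] aNE XC]]] := qX.
have {}aNE : a0 \notin E by apply/negP => aE'; apply: aNE; rewrite /pts /= aE -memvE.
have [e0 e0n xE] := proj_pointP x.
move: Cx; rewrite CE => -[]; rewrite /pts /= xE -memvE => e0E gx.
pose e := vsproj E e0; have eE : vsval e = e0 by rewrite vsprojK.
have ge : g e e = 0 by apply: gx; rewrite eE memv_line.
have [d ged] : exists d, g e d != 0.
  apply: contrapT => /forallNP ged; case/eqP: e0n; rewrite -eE.
  move/nondegenerateP: ndg => /(_ e) ->; first by rewrite linear0.
  by move=> v; apply/eqP/negPn/negP/ged.
have [k gdd] := isotropize two_neq0 ge ged.
have {d gdd ged} [d [gd ged]] : exists d, g d d = 0 /\ g e d != 0.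
  by exists (d + k *: e); split=> //; rewrite symDr symZr ge mulr0 addr0.
have isoW (v : subvs_of E) u : vsval v != 0 -> g v v = 0 ->
    u \in (<[a0]> + <[vsval v]>)%VS -> f u u = 0 /\ u \in W.
  move=> v0; have [->|u0] := eqVneq u 0; first by split; [rewrite sym0l|exact: mem0v].
  move=> gv uv; have : sval X (span_point u0).
    rewrite XC CE; exists (span_point v0); last by rewrite /pts /= aE -memvE.
    split; first by rewrite /pts /= -memvE subvsP.
    move=> v' /vlineP[m v'E].
    have -> : v' = m *: v.
      by apply: val_inj; rewrite [RHS]vsvalZ.
    by rewrite !symE gv !mulr0.
  rewrite XE coneE => -[fu]; rewrite /pts /= -memvE => uW; split => //.
  by apply: fu; rewrite memv_line.
have isoP (v : subvs_of E) : vsval v != 0 -> g v v = 0 ->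
    [/\ f a0 (vsval v) = 0, f (vsval v) (vsval v) = 0 & vsval v \in W].
  move=> v0 gv; have vav : vsval v \in (<[a0]> + <[vsval v]>)%VS.
    by rewrite mem_line_addr // memv_line.
  have [vv vW] := isoW v _ v0 gv vav; split=> //.
  (* Isotropy of [a0 + vsval v] yields orthogonality of the two summands. *)
  have [+ _] := isoW v _ v0 gv (memvD (mem_line_addl a0 _) vav).
  rewrite !symE aa vv add0r addr0 (symC f _ a0) -mulr2n -mulr_natl => /eqP.
  by rewrite mulf_eq0 (negPf two_neq0) => /eqP.
have e0' : vsval e != 0 by rewrite eE.
have d0 : vsval d != 0.
  by apply: contraNneq ged => d0; rewrite (_ : d = 0) ?sym0r //; exact: val_inj.
have [ae ee eW] := isoP e e0' ge; have [ad dd dW] := isoP d d0 gd.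
exists (vsval e), (vsval d); split; last first.
  exists W; rewrite -coneE; split; [exact: XE|split=> //].
  by have [_] := isoW e _ e0' ge (mem_line_addl a0 _).
split=> //; apply/negP => /eqP ed.
have dimed : \dim (<[vsval e]> + <[vsval d]>) = 2%N.
  rewrite dim_line_add ?dim_vline ?d0 //.
  apply: contraNN ged => /vlineP[m em]; have -> : e = m *: d.
    by apply: val_inj; rewrite [RHS]vsvalZ.
  by rewrite symZl gd mulr0.
have : a0 \in (<[vsval e]> + <[vsval d]>)%VS.
  apply: vX dimed _; rewrite XE coneE => z zed; split; last first.
    by apply: subv_trans zed _; rewrite subv_add -!memvE eW.
  move=> u /(subvP zed) /memv_line_addP[m /vlineP[m' /eqP]]; rewrite subr_eq => /eqP ->.
  by rewrite !symE (symC f (vsval d)) ee dd ed !(mulr0, addr0).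
apply/negP; apply: contraNN aNE; apply: subvP.
by rewrite subv_add -!memvE !subvsP.
Qed.

Section Chain.
Variables (X : projective_cone T Q) (W : {vspace V}) (L : projective_line T Q).
Variable l : V.
Hypotheses (XE : sval X = isotropic f `&` pts W) (aW : a0 \in W).
Hypotheses (LE : sval L = (<[l]> + <[a0]>)%VS) (al : f a0 l = 0) (ll : f l l = 0).

Lemma share_line p q : hyperbolic a0 p q -> p \in W -> q \in W ->
    f l p != 0 -> f l q != 0 ->
  exists Y, share_lines X Y /\ line_points L `<=` sval Y.
Proof.
move=> pq pW qW lp lq.
have [Y [_ [W' [YE [aW' pW' qW' lW']]]]] := ex_cone_isotropic aE Sa pq al ll lp lq.
exists Y; split; first exact: (share_of aE Sa pq XE YE).
by apply: line_sub_cone YE _; rewrite LE subv_add -!memvE lW'.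
Qed.

End Chain.

(** Projecting away from [p] and [q] does not change the product with [l]. If the resulting [y] is
    isotropic, [y + l] is not, since [f (y + l) (y + l) = 2 * f l y]. *)
Lemma ex_anisotropic_at p q l : hyperbolic a0 p q -> f a0 l = 0 -> f l l = 0 ->
    l \notin (<[a0]> + T)%VS -> f l p = 0 -> f l q = 0 ->
  exists w, [/\ f a0 w = 0, f w p = 0, f w q = 0, f w w != 0 & f l w != 0].
Proof.
move=> [ap aq pp qq pq] al ll lT lp lq; have [y0 [ay0 ly0]] := ex_perp_dual al lT.
have [y [ay yp yq ly]] : exists y, [/\ f a0 y = 0, f y p = 0, f y q = 0 & f l y != 0].
  exists (y0 - (f y0 q / f p q) *: p - (f y0 p / f p q) *: q); split.
  - by rewrite !symE ap aq ay0; ring.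
  - by rewrite !symE pp (symC f q p); field.
  - by rewrite !symE qq; field.
  - by rewrite !symE lp lq !mulr0 !oppr0 !addr0.
have [yy|yy] := eqVneq (f y y) 0; last by exists y.
exists (y + l); split; rewrite ?symDl ?symDr.
- by rewrite ay al addr0.
- by rewrite yp lp addr0.
- by rewrite yq lq addr0.
- by rewrite yy ll (symC f y l) add0r addr0 -mulr2n -mulr_natl mulf_neq0.
- by rewrite ll addr0.
Qed.

Lemma cone_chain X L : vertex X a -> (val a <= sval L)%VS ->
  exists X1 X2, share_lines X X1 /\ (share_lines X1 X2 /\ line_points L `<=` sval X2).
Proof.
move=> /cone_hyperbolic [p [q [pq [W [XE [aW pW qW]]]]]].
move=> /(line_through aE) [l [LE _ al ll lT]].
(* Lets [X] itself play the part of [X1] when one further cone suffices. *)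
have shXX : share_lines X X.
  exact: (share_of aE Sa pq XE XE).
have mkX1 p1 q1 w : hyperbolic a0 p1 q1 -> p1 \in W -> q1 \in W ->
    f a0 w = 0 -> f w p1 = 0 -> f w q1 = 0 -> f w w != 0 ->
    exists X1 W1, [/\ share_lines X X1, sval X1 = isotropic f `&` pts W1, a0 \in W1 &
      forall x y z, x *: p1 + y *: q1 + z *: w \in W1].
  move=> pq1 pW1 qW1 aw wp wq ww.
  have [X1 [_ X1E]] := ex_cone_anisotropic aE Sa pq1 aw wp wq ww.
  have W1P x y z : x *: p1 + y *: q1 + z *: w
      \in (<[a0]> + (<[p1]> + (<[q1]> + <[w]>)))%VS.
    by rewrite mem_line_addr // memv_span3.
  exists X1, (<[a0]> + (<[p1]> + (<[q1]> + <[w]>)))%VS; split => //;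
    last exact: mem_line_addl.
  apply: (share_of aE Sa pq1 XE X1E) => //; first exact: mem_line_addl.
  - by have := W1P 1 0 0; rewrite scale1r !scale0r !addr0.
  - by have := W1P 0 1 0; rewrite scale1r !scale0r add0r addr0.
have one_perp p1 q1 : hyperbolic a0 p1 q1 -> p1 \in W -> q1 \in W ->
    f l p1 = 0 -> f l q1 != 0 ->
  exists X1 X2, share_lines X X1 /\ (share_lines X1 X2 /\ line_points L `<=` sval X2).
  move=> pq1 pW1 qW1 lp lq; have [w [aw wp wq ww]] := ex_anisotropic pq1.
  have [X1 [W1 [shX X1E aW1 W1P]]] := mkX1 _ _ _ pq1 pW1 qW1 aw wp wq ww.
  have [ap aq pp qq pqn] := pq1.
  (* Makes [s *: p1 + q1 + r *: w] isotropic whenever [r * r = 1]. *)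
  pose s := - f w w / (2 * f p1 q1).
  (* The values for [r = 1] and [r = -1] add up to [2 * f l q1], so they are not both zero. *)
  have [r r2 lx] : exists2 r : F, r * r = 1 & f l q1 + r * f l w != 0.
    have [lw|lw] := eqVneq (f l q1 + f l w) 0; last by exists 1; rewrite !mul1r.
    exists (-1); first by rewrite mulrNN mulr1.
    have -> : f l q1 + -1 * f l w = 2 * f l q1 - (f l q1 + f l w) by ring.
    by rewrite lw subr0 mulf_neq0.
  have qx : hyperbolic a0 q1 (s *: p1 + q1 + r *: w).
    split=> //.
    - by rewrite !symE ap aq aw; ring.
    - have -> : f (s *: p1 + q1 + r *: w) (s *: p1 + q1 + r *: w) =
          2 * s * f p1 q1 + (r * r) * f w w.
        by rewrite !symE (symC f q1 p1) (symC f p1 w) (symC f q1 w) pp qq wp wq; ring.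
      by rewrite r2 /s; field; apply/andP.
    - rewrite !symE qq (symC f q1 w) (symC f q1 p1) wq !(mulr0, addr0) /s.
      by rewrite !mulf_neq0 // ?oppr_eq0 ?invr_eq0 // mulf_neq0.
  have q1W : q1 \in W1 by have := W1P 0 1 0; rewrite scale1r !scale0r add0r addr0.
  have xW : s *: p1 + q1 + r *: w \in W1 by have := W1P s 1 r; rewrite scale1r.
  have [||X2 [shX1 LX2]] := share_line X1E aW1 LE al ll qx q1W xW.
  - exact: lq.
  - by rewrite !symE lp mulr0 add0r.
  by exists X1, X2.
have [lp|lp] := eqVneq (f l p) 0; have [lq|lq] := eqVneq (f l q) 0.
- have [w [aw wp wq ww lw]] := ex_anisotropic_at pq al ll lT lp lq.
  have [X1 [W1 [shX X1E aW1 W1P]]] := mkX1 _ _ _ pq pW qW aw wp wq ww.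
  have [ap aq pp qq pqn] := pq.
  pose s := - f w w / (2 * f p q).
  (* Both vectors are isotropic by the choice of [s]; their products with [l] are [f l w] and its
     opposite, as [l] is orthogonal to [p] and [q]. *)
  have xx : hyperbolic a0 (s *: p + q + w) (s *: p + q - w).
    split.
    + by rewrite !symE ap aq aw; ring.
    + by rewrite !symE ap aq aw; ring.
    + rewrite !symE (symC f q p) (symC f p w) (symC f q w) pp qq wp wq /s.
      by field; apply/andP.
    + rewrite !symE (symC f q p) (symC f p w) (symC f q w) pp qq wp wq /s.
      by field; apply/andP.
    + have -> : f (s *: p + q + w) (s *: p + q - w) = - (2 * f w w).
        rewrite !symE (symC f q p) (symC f p w) (symC f q w) pp qq wp wq /s.
        by field; apply/andP.
      by rewrite oppr_eq0 mulf_neq0.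
  have xW : s *: p + q + w \in W1 by have := W1P s 1 1; rewrite !scale1r.
  have yW : s *: p + q - w \in W1 by have := W1P s 1 (-1); rewrite scale1r scaleN1r.
  have [||X2 [shX1 LX2]] := share_line X1E aW1 LE al ll xx xW yW.
  - by rewrite !symE lp lq mulr0 !add0r.
  - by rewrite !symE lp lq mulr0 !add0r oppr_eq0.
  by exists X1, X2.
- exact: (one_perp p q).
- by apply: (one_perp q p) => //; exact: hyperbolicC.
- by have [X2 [shX LX2]] := share_line XE aW LE al ll pq pW qW lp lq; exists X, X2.
Qed.

(** The line [R] of the ruled quadric supplies an isotropic [p] orthogonal to [a0] outside [<[a0]> +
    T]. If none existed, [a0] would agree modulo [T] with a vector of [R] up to scaling, so all of
    [R] would be orthogonal to [a0] and lie in [<[a0]> + T], which is too small to contain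
    [R + T]. *)
Lemma ex_cone_at (R : {vspace V}) : \dim R = 2%N -> (R :&: T = 0)%VS ->
    (forall u v, u \in R -> v \in R -> f u v = 0) ->
  exists X, vertex X a.
Proof.
move=> dimR RT fR.
have [p [pR ap pT]] : exists p, [/\ p \in R, f a0 p = 0 & p \notin (<[a0]> + T)%VS].
  apply: contrapT => /forallNP noP.
  have {}noP p : p \in R -> f a0 p = 0 -> p \in (<[a0]> + T)%VS.
    by move=> pR ap; apply/negPn/negP => pT; apply: (noP p); split.
  have : (0 < \dim (R :&: orthov f <[a0]>))%N.
    by apply: leq_trans (leq_dim_orthov1 f a0 R); rewrite dimR.
  rewrite lt0n dimv_eq0 -vpick0; have := memv_pick (R :&: orthov f <[a0]>)%VS.
  set u := vpick _; rewrite memv_cap mem_orthov1 symC => /andP[uR /eqP au] u0.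
  have /memv_line_addP[k ukT] := noP u uR au.
  have k0 : k != 0.
    apply: contraNneq u0 => k0; move: ukT; rewrite k0 scale0r subr0 => uT.
    by rewrite -memv0 -RT memv_cap uR.
  have : (R <= <[a0]> + T)%VS.
    apply/subvP => v vR; apply: noP => //; apply/eqP.
    have := rad_sym v ukT; rewrite !symE fR // add0r => /eqP.
    by rewrite oppr_eq0 mulf_eq0 (negPf k0).
  move=> RaT; have : (R + T <= <[a0]> + T)%VS by rewrite subv_add RaT addvSr.
  move=> /dimvS; rewrite dimv_disjoint_sum // dimR dim_line_add //.
  by rewrite addSn ltnn.
have [y [ay py]] := ex_perp_dual ap pT.
have [k yy] := isotropize two_neq0 (fR _ _ pR pR) py.
have pq : hyperbolic a0 p (y + k *: p).
  split=> //; first by rewrite !symE ap ay mulr0 addr0.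
  - by rewrite fR.
  - by rewrite symDr symZr (fR _ _ pR pR) mulr0 addr0.
have [w [aw wp wq ww]] := ex_anisotropic pq.
by have [X [vX _]] := ex_cone_anisotropic aE Sa pq aw wp wq ww; exists X.
Qed.

End Completeness.

End Laguerre.

(** * The defining formula and its correctness *)

Definition share_formula m n (i j : 'I_n) : formula m n :=
  let K : 'I_m.+2 := Ordinal (isT : 1 < m.+2)%N in
  let K' : 'I_m.+2 := Ordinal (isT : 0 < m.+2)%N in
  Ex1 (Ex1 (And (Not (@Eq1 _ n K K'))
    (And (And (Rel K i) (Rel K' i)) (And (Rel K j) (Rel K' j))))).

(* The second sort is bound in the order X, X1, X2, so X has index 2. *)
Definition pencil_formula : formula 1 1 :=
  let X := Ordinal (isT : 2 < 3)%N in
  let X1 := Ordinal (isT : 1 < 3)%N in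
  let X2 := Ordinal (isT : 0 < 3)%N in
  Ex2 (Ex2 (And (share_formula 1 X X1)
    (And (share_formula 1 X1 X2) (Rel ord0 X2)))).

Lemma holds_pencil_formula (F : fieldType) (V : vectType F) (T : {vspace V})
    (Q : set (proj_point V)) (L : projective_line T Q) (X : projective_cone T Q) :
  holds (M := conic_pencils T Q) pencil_formula [tuple L] [tuple X] <->
  exists X1 X2, share_lines X X1 /\ (share_lines X1 X2 /\ line_points L `<=` sval X2).
Proof. by []. Qed.

Theorem corollary5p9 (F : fieldType) (V : vectType F) (T B : {vspace V})
    (Q : set (proj_point V)) (nu : nat)
    (char_neq2 : 2%N \notin [pchar F])
    (T_nonempty : T != 0%VS) (B_nonempty : B != 0%VS)
    (TB_disjoint : (T :&: B = 0)%VS) (TB_span : (T + B = fullv)%VS)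
    (Q_quadric : nondegenerate_quadric B Q) (Q_ruled : ruled Q)
    (nu_def : nu = (proj_dim B - 1)%N) (nu_ge3 : (3 <= nu)%N) :
  definable_family (M := conic_pencils T Q)
    [set pencil T Q a | a in laguerre_points T Q].
Proof.
have two_neq0 : (2 : F) != 0 by move: char_neq2; rewrite inE.
have BT_disjoint : (B :&: T = 0)%VS by rewrite capvC.
have dimV : (\dim T + 5 <= \dim {:V})%N.
  rewrite -TB_span dimv_disjoint_sum // leq_add2l.
  (* Both subtractions are truncated, so each vector dimension of [B] up to 4 gives [nu] at most
     2. *)
  by move: nu_ge3; rewrite nu_def /proj_dim; case: (\dim B) => [|[|[|[|[|n]]]]].
have [g ndg QE] := Q_quadric.
(* The projection onto [B] along [T]; its kernel [T] becomes the radical of [f] because [g] is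
   nondegenerate. *)
pose pi : {linear V -> subvs_of B} := vsproj B \o daddv_pi B T.
have piE v : pi v = vsproj B (daddv_pi B T v) by [].
pose f : {symmetric V} := pullback_form g pi.
have fE u v : f u v = g (pi u) (pi v) by [].
have piB b : b \in B -> vsval (pi b) = b.
  by move=> bB; rewrite piE daddv_pi_id // vsprojK.
have piT t : t \in T -> pi t = 0.
  move=> tT; have tBT : t \in (B + T)%VS by rewrite addvC TB_span memvf.
  have := daddv_pi_add BT_disjoint tBT; rewrite (daddv_pi_id TB_disjoint tT).
  rewrite -[RHS]add0r => /addIr pit.
  by rewrite piE pit linear0.
have decV v : exists2 t, t \in T & v = t + vsval (pi v).
  have := memvf v; rewrite -TB_span => /memv_addP[t tT [b bB ->]].
  exists t => //; suff -> : pi (t + b) = pi b by rewrite piB.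
  by rewrite (linearD pi) (piT t tT) add0r.
have radP u : (forall v, f u v = 0) <-> u \in T.
  split=> [fu|uT v]; last by rewrite fE piT // sym0l.
  have [t tT ->] := decV u; suff -> : pi u = 0 by rewrite linear0 addr0.
  move/nondegenerateP: ndg; apply => b; have := fu (vsval b).
  rewrite fE; suff -> : pi (vsval b) = b by [].
  by apply: val_inj; rewrite /= piB // subvsP.
have [R dimR RQ] := Q_ruled.
have {}dimR : \dim R = 2%N by move: dimR; rewrite /proj_dim; case: (\dim R) => //= n ->.
have coneE : cone T Q = isotropic f.
  have gf (u v : subvs_of B) : g u v = f (vsval u) (vsval v).
    by rewrite fE; congr (g _ _); apply: val_inj; rewrite /= piB // subvsP.
  have fT t u : t \in T -> u \in (T + B)%VS -> f t u = 0.
    by move=> tT _; rewrite fE piT // sym0l.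
  have Q0 : quadric_of g !=set0.
    have R0 : vpick R != 0 by rewrite vpick0 -dimv_eq0 dimR.
    by exists (span_point R0); rewrite -QE; apply: RQ; rewrite /pts /= -memvE memv_pick.
  rewrite QE (cone_isotropic fT gf Q0) TB_span.
  by apply/seteqP; split=> [z []|z fz] //; split=> //; exact: subvf.
have RB : (R <= B)%VS by apply: subset_pts => z /RQ; rewrite QE => -[].
have RT : (R :&: T = 0)%VS by apply/eqP; rewrite -subv0 -BT_disjoint capvS.
have Riso : forall u v, u \in R -> v \in R -> f u v = 0.
  apply/(pts_isotropicP two_neq0) => z Rz; rewrite -coneE.
  by exists z; [exact: RQ | exact: addvSr].
(* The parameter cone serves as a name for its vertex. *)
have defines X a : vertex X a ->
    [set L | holds (M := conic_pencils T Q) pencil_formula [tuple L] [tuple X]] =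
    pencil T Q a.
  move=> vX; have [a0 _ aE] := proj_pointP a; apply/seteqP; split=> L; last first.
    move=> aL; apply/holds_pencil_formula.
    exact: (cone_chain two_neq0 coneE radP aE vX.1 dimV vX).
  move=> /holds_pencil_formula [X1 [X2 [XX1 [X12 LX2]]]].
  have [[b vX1] [c vX2]] := (ex_vertex X1, ex_vertex X2).
  rewrite (share_vertex two_neq0 XX1 vX vX1) (share_vertex two_neq0 X12 vX1 vX2).
  exact: (vertex_line two_neq0 vX2 LX2).
(* One inclusion needs a vertex for each cone, the other a cone for each point. *)
exists pencil_formula; apply/seteqP; split=> [A [X _ <-]|A [a Sa <-]].
  by have [a vX] := ex_vertex X; exists a; [exact: vX.1 | rewrite (defines X a)].
have [a0 _ aE] := proj_pointP a.
have [X vX] := ex_cone_at two_neq0 coneE radP aE Sa dimV dimR RT Riso.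
by exists X => //; exact: defines.
Qed.
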